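(* Let $V$ be a quantum vertex algebra over $\mathbb C[[h]]$ with center $\mathfrak z(V)$. For any $w\in V$ and any $v,u\in\mathfrak z(V)$ we have $$Y(z_1)\big(1\otimes Y(z_2)\big)\big(\mathcal S(z_1-z_2)(v\otimes w)\otimes u\big)=Y(z_2)\big(1\otimes Y(z_1)\big)(w\otimes v\otimes u).$$
   Context: Conventions. $V=V_0[[h]]$ ($V_0$ a complex vector space) is a topologically free $\mathbb C[[h]]$-module; tensor products are $h$-adically completed, e.g. $V\otimes V\otimes\mathbb C((z))=(V_0\otimes V_0\otimes\mathbb C((z)))[[h]]$. $V_h((z))$ is the space of series $\sum_{r\in\mathbb Z}v_rz^{-r-1}\in V[[z^{\pm1}]]$ with $v_r\to0$ $h$-adically as $r\to\infty$. For $\ell<0$, $(z\pm w)^{\ell}$ is expanded into a Taylor series in the variable on the right ($w$); in particular $\mathcal S(z_1-z_2)$ is expanded in nonnegative powers of $z_2$. A quantum vertex algebra over $\mathbb C[[h]]$ is such a $V$ with the following data. (a) A $\mathbb C[[h]]$-module map $Y(z):V\otimes V\to V_h((z))$; write $Y(v,z)w=Y(z)(v\otimes w)=\sum_{r\in\mathbb Z}(v_rw)z^{-r-1}$, where $v_rw$ is the $r$-product. Weak associativity: for any $u,v,w\in V$, $n\geqslant0$ there is $\ell\geqslant0$ with $(z_0+z_2)^\ell Y(v,z_0+z_2)Y(w,z_2)u-(z_0+z_2)^\ell Y(Y(v,z_0)w,z_2)u\in h^nV[[z_0^{\pm1},z_2^{\pm1}]]$. (b) A vector $\mathbf 1\in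 V$ such that $Y(\mathbf 1,z)v=v$ for all $v$, and $Y(v,z)\mathbf 1$ is a Taylor series in $z$ with value $v$ at $z=0$. (c) A $\mathbb C[[h]]$-module map $D:V\to V$ with $D\mathbf 1=0$ and $\frac{d}{dz}Y(v,z)=[D,Y(v,z)]$ for all $v$. (d) A $\mathbb C[[h]]$-module map $\mathcal S=\mathcal S(z):V\otimes V\to V\otimes V\otimes\mathbb C((z))$ with $[D\otimes1,\mathcal S(z)]=-\frac{d}{dz}\mathcal S(z)$; $\mathcal S_{12}(z_1)\mathcal S_{13}(z_1+z_2)\mathcal S_{23}(z_2)=\mathcal S_{23}(z_2)\mathcal S_{13}(z_1+z_2)\mathcal S_{12}(z_1)$; $\mathcal S_{21}(z)=\mathcal S^{-1}(-z)$; and $\mathcal S$-locality: for any $v,w\in V$, $n\geqslant0$ there is $\ell\geqslant0$ such that for any $u\in V$, $(z_1-z_2)^\ell Y(z_1)(1\otimes Y(z_2))(\mathcal S(z_1-z_2)(v\otimes w)\otimes u)-(z_1-z_2)^\ell Y(z_2)(1\otimes Y(z_1))(w\otimes v\otimes u)\in h^nV[[z_1^{\pm1},z_2^{\pm1}]]$. The center of $V$ is $\mathfrak z(V)=\{v\in V\mid w_rv=0\text{ for all }w\in V\text{ and all }r\geqslant0\}$. (The property in the claim is called $\mathcal S$-commutativity of the center.) *)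

(* Defs.v *)
From HB Require Import structures.
From mathcomp Require Import all_boot all_order all_algebra.
From mathcomp Require Import boolp classical_sets functions cardinality fsbigop.

Set Implicit Arguments.
Unset Strict Implicit.
Unset Printing Implicit Defensive.

Import Order.TTheory GRing.Theory.
Local Open Scope ring_scope.

(* The tensor product of two modules: a sequence of pairs (a, b) stands for    *)
(* the sum of the pure tensors of a and b, and [tens_rel] is the congruence    *)
(* generated by the bilinearity relations.                                    *)
Inductive tens_rel (F : comNzRingType) (A B : lmodType F) :
    seq (A * B) -> seq (A * B) -> Prop :=
  | tens_refl s : tens_rel s s
  | tens_sym s t : tens_rel s t -> tens_rel t s
  | tens_trans s t u : tens_rel s t -> tens_rel t u -> tens_rel s u
  | tens_cat s1 s2 t1 t2 :
      tens_rel s1 t1 -> tens_rel s2 t2 -> tens_rel (s1 ++ s2) (t1 ++ t2)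
  | tens_catC s t : tens_rel (s ++ t) (t ++ s)
  | tens_0 b : tens_rel [:: (0, b)] [::]
  | tens_Dl a a' b : tens_rel [:: (a + a', b)] [:: (a, b); (a', b)]
  | tens_Dr a b b' : tens_rel [:: (a, b + b')] [:: (a, b); (a, b')]
  | tens_Z k a b : tens_rel [:: (k *: a, b)] [:: (a, k *: b)].

Section Tensor.
Variables (F : comNzRingType) (A B : lmodType F).
Implicit Types s t : seq (A * B).

Definition tens_relb s t : bool := `[< tens_rel s t >].

Lemma tens_relb_refl : reflexive tens_relb.
Proof. by move=> s; apply/asboolP; exact: tens_refl. Qed.

Lemma tens_relb_sym : symmetric tens_relb.
Proof. by move=> s t; apply/asboolP/asboolP; exact: tens_sym. Qed.

Lemma tens_relb_trans : transitive tens_relb.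
Proof.
by move=> s t u /asboolP st /asboolP tu; apply/asboolP; exact: tens_trans st tu.
Qed.

Definition tens_equiv :=
  EquivRel tens_relb tens_relb_refl tens_relb_sym tens_relb_trans.

Definition tensor := {eq_quot tens_equiv}%qT.

HB.instance Definition _ := Choice.on tensor.
HB.instance Definition _ := EqQuotient.on tensor.

Definition tens_sum s : tensor := (\pi_(tensor) s)%qT.

Lemma tens_sumP s t : reflect (tens_rel s t) (tens_sum s == tens_sum t).
Proof. by rewrite /tens_sum eqmodE; exact: asboolP. Qed.

Lemma eq_tens_sum s t : tens_rel s t -> tens_sum s = tens_sum t.
Proof. by move=> st; apply/eqP/tens_sumP. Qed.

Lemma tens_repr (x : tensor) : tens_sum (repr x) = x.
Proof. exact: reprK. Qed.

Lemma tens_repr_rel s : tens_rel (repr (tens_sum s)) s.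
Proof. by apply/tens_sumP; rewrite tens_repr. Qed.

Definition tens_add (x y : tensor) := tens_sum (repr x ++ repr y).
Definition tens_scale k (x : tensor) :=
  tens_sum [seq (k *: p.1, p.2) | p <- repr x].

Lemma tens_addE s t : tens_add (tens_sum s) (tens_sum t) = tens_sum (s ++ t).
Proof. by apply: eq_tens_sum; apply: tens_cat; exact: tens_repr_rel. Qed.

Lemma tens_scaleE k s :
  tens_scale k (tens_sum s) = tens_sum [seq (k *: p.1, p.2) | p <- s].
Proof.
apply: eq_tens_sum.
move: (tens_repr_rel s); move: (repr _) => s'; elim=> {s s'} /=.
- by move=> *; exact: tens_refl.
- by move=> *; exact: tens_sym.
- by move=> s t u _ IH _ IH'; exact: tens_trans IH IH'.
- by move=> s1 s2 t1 t2 _ IH _ IH'; rewrite !map_cat; exact: tens_cat.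
- by move=> s t; rewrite !map_cat; exact: tens_catC.
- by move=> b; rewrite scaler0; exact: tens_0.
- by move=> a a' b; rewrite scalerDr; exact: tens_Dl.
- by move=> a b b'; exact: tens_Dr.
- by move=> l a b; rewrite scalerA mulrC -scalerA; exact: tens_Z.
Qed.

Lemma tensW (P : tensor -> Prop) : (forall s, P (tens_sum s)) -> forall x, P x.
Proof. by move=> Ps x; rewrite -(tens_repr x). Qed.

Lemma tens_addA : associative tens_add.
Proof.
by elim/tensW=> s; elim/tensW=> t; elim/tensW=> u; rewrite !tens_addE catA.
Qed.

Lemma tens_addC : commutative tens_add.
Proof.
elim/tensW=> s; elim/tensW=> t; rewrite !tens_addE.
by apply: eq_tens_sum; exact: tens_catC.
Qed.

Lemma tens_add0 : left_id (tens_sum [::]) tens_add.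
Proof. by elim/tensW=> s; rewrite !tens_addE. Qed.

Lemma tens_addZ k l x :
  tens_scale (k + l) x = tens_add (tens_scale k x) (tens_scale l x).
Proof.
elim/tensW: x => s; rewrite !tens_scaleE tens_addE; apply: eq_tens_sum.
elim: s => [|[a b] s IH] /=; first exact: tens_refl.
apply: (@tens_trans _ _ _ _
  ([:: (k *: a, b); (l *: a, b)] ++ ([seq (k *: p.1, p.2) | p <- s] ++
     [seq (l *: p.1, p.2) | p <- s]))).
  by rewrite -cat1s scalerDl; apply: tens_cat => //; exact: tens_Dl.
rewrite /= -cat1s -[X in tens_rel _ X]cat1s.
apply: tens_cat; first exact: tens_refl.
rewrite -cat1s -[in X in tens_rel _ X]cat1s !catA.
by apply: tens_cat; [exact: tens_catC|exact: tens_refl].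
Qed.

Lemma tens_addN : left_inverse (tens_sum [::]) (tens_scale (-1)) tens_add.
Proof.
move=> x; have -> : tens_add (tens_scale (-1) x) x =
    tens_add (tens_scale (-1) x) (tens_scale 1 x).
  congr tens_add; elim/tensW: x => s; rewrite tens_scaleE.
  congr tens_sum; rewrite -[LHS]map_id; apply: eq_map => -[a b] /=.
  by rewrite scale1r.
rewrite -tens_addZ addNr; elim/tensW: x => s; rewrite tens_scaleE.
apply: eq_tens_sum; elim: s => [|[a b] s IH] /=; first exact: tens_refl.
by rewrite scale0r -cat1s -[[::]]cats0; apply: tens_cat => //; exact: tens_0.
Qed.

HB.instance Definition _ :=
  GRing.isZmodule.Build tensor tens_addA tens_addC tens_add0 tens_addN.

Lemma tens_scaleA k l x :
  tens_scale k (tens_scale l x) = tens_scale (k * l) x.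
Proof.
elim/tensW: x => s; rewrite !tens_scaleE -map_comp; congr tens_sum.
by apply: eq_map => -[a b] /=; rewrite scalerA.
Qed.

Lemma tens_scale1 : left_id 1 tens_scale.
Proof.
elim/tensW=> s; rewrite tens_scaleE; congr tens_sum.
by rewrite -[RHS]map_id; apply: eq_map => -[a b] /=; rewrite scale1r.
Qed.

Lemma tens_scaleDr : right_distributive tens_scale +%R.
Proof.
move=> k; elim/tensW=> s; elim/tensW=> t.
have addE (x y : tensor) : x + y = tens_add x y by [].
by rewrite !addE (tens_addE s t) (tens_scaleE k s) (tens_scaleE k t) tens_addE
  tens_scaleE map_cat.
Qed.

Lemma tens_scaleDl x : {morph tens_scale^~ x : k l / k + l}.
Proof. by move=> k l; rewrite tens_addZ. Qed.

HB.instance Definition _ := GRing.Zmodule_isLmodule.Build F tensor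
  tens_scaleA tens_scale1 tens_scaleDr tens_scaleDl.

Definition pure (a : A) (b : B) : tensor := tens_sum [:: (a, b)].

Lemma tens_sumE s : tens_sum s = \sum_(p <- s) pure p.1 p.2.
Proof.
elim: s => [|[a b] s IH]; first by rewrite big_nil.
by rewrite big_cons -IH [RHS]tens_addE.
Qed.

Lemma pureDl a a' b : pure (a + a') b = pure a b + pure a' b.
Proof. by rewrite [RHS]tens_addE; apply: eq_tens_sum; exact: tens_Dl. Qed.

Lemma pureDr a b b' : pure a (b + b') = pure a b + pure a b'.
Proof. by rewrite [RHS]tens_addE; apply: eq_tens_sum; exact: tens_Dr. Qed.

Lemma pureZl k a b : pure (k *: a) b = k *: pure a b.
Proof. by rewrite [RHS]tens_scaleE. Qed.

Lemma pureZr k a b : pure a (k *: b) = k *: pure a b.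
Proof. by rewrite -pureZl; apply/esym/eq_tens_sum; exact: tens_Z. Qed.

Lemma pure0l b : pure 0 b = 0.
Proof. by rewrite -(scale0r 0) pureZl scale0r. Qed.

Lemma pure0r a : pure a 0 = 0.
Proof. by rewrite -(scale0r 0) pureZr scale0r. Qed.

Lemma pure_suml I (r : seq I) (P : pred I) (a : I -> A) b :
  pure (\sum_(i <- r | P i) a i) b = \sum_(i <- r | P i) pure (a i) b.
Proof.
exact: (big_morph (fun a => pure a b) (fun a a' => pureDl a a' b) (pure0l b)).
Qed.

Lemma pure_sumr I (r : seq I) (P : pred I) a (b : I -> B) :
  pure a (\sum_(i <- r | P i) b i) = \sum_(i <- r | P i) pure a (b i).
Proof. exact: (big_morph (pure a) (pureDr a) (pure0r a)). Qed.

Lemma tens_sumD s t : tens_sum s + tens_sum t = tens_sum (s ++ t).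
Proof. exact: tens_addE. Qed.

Lemma tens_sumZ k s : k *: tens_sum s = tens_sum [seq (k *: p.1, p.2) | p <- s].
Proof. exact: tens_scaleE. Qed.

(* The map on the tensor product induced by a bilinear f; see [tlift_sum].    *)
Definition tlift (W : zmodType) (f : A -> B -> W) (x : tensor) : W :=
  \sum_(p <- repr x) f p.1 p.2.

Lemma tlift_sum (W : zmodType) (f : A -> B -> W) s :
    (forall a a' b, f (a + a') b = f a b + f a' b) ->
    (forall a b b', f a (b + b') = f a b + f a b') ->
    (forall k a b, f (k *: a) b = f a (k *: b)) ->
  tlift f (tens_sum s) = \sum_(p <- s) f p.1 p.2.
Proof.
move=> fDl fDr fZ; rewrite /tlift.
move: (tens_repr_rel s); move: (repr _) => s'; elim=> {s s'} /=.
- by [].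
- by [].
- by move=> s t u _ -> _ ->.
- by move=> s1 s2 t1 t2 _ IH _ IH'; rewrite !big_cat IH IH'.
- by move=> s t; rewrite !big_cat /= addrC.
- move=> b; rewrite big_seq1 big_nil /=.
  by apply: (addrI (f 0 b)); rewrite -fDl !addr0.
- by move=> a a' b; rewrite !big_cons !big_nil /= !addr0 fDl.
- by move=> a b b'; rewrite !big_cons !big_nil /= !addr0 fDr.
- by move=> k a b; rewrite !big_seq1 /= fZ.
Qed.

End Tensor.

(* [hser A] is A[[h]]; a record, since [nat -> A] already carries the          *)
(* pointwise ring structure.                                                  *)
Record hser (A : Type) := HSer { hcoef : nat -> A }.

Lemma hserK A : cancel (@hcoef A) (@HSer A).
Proof. by case. Qed.

HB.instance Definition _ (A : choiceType) :=
  Choice.copy (hser A) (can_type (@hserK A)).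

Lemma hserP A (x y : hser A) : hcoef x =1 hcoef y -> x = y.
Proof. by case: x => x; case: y => y /= /funext ->. Qed.

Section HserZmodule.
Variable A : zmodType.
Implicit Types x y : hser A.

Definition hser_add x y := HSer (fun n => hcoef x n + hcoef y n).
Definition hser_opp x := HSer (fun n => - hcoef x n).
Definition hser_zero : hser A := HSer (fun=> 0).

Lemma hser_addA : associative hser_add.
Proof. by move=> x y z; apply: hserP => n; exact: addrA. Qed.
Lemma hser_addC : commutative hser_add.
Proof. by move=> x y; apply: hserP => n; exact: addrC. Qed.
Lemma hser_add0 : left_id hser_zero hser_add.
Proof. by move=> x; apply: hserP => n; exact: add0r. Qed.
Lemma hser_addN : left_inverse hser_zero hser_opp hser_add.
Proof. by move=> x; apply: hserP => n; exact: addNr. Qed.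

HB.instance Definition _ := GRing.isZmodule.Build (hser A)
  hser_addA hser_addC hser_add0 hser_addN.

Lemma hcoef0 n : hcoef (0 : hser A) n = 0. Proof. by []. Qed.
Lemma hcoefD x y n : hcoef (x + y) n = hcoef x n + hcoef y n. Proof. by []. Qed.
Lemma hcoefN x n : hcoef (- x) n = - hcoef x n. Proof. by []. Qed.

End HserZmodule.

Lemma triangle_sum (A : zmodType) (G : nat -> nat -> nat -> A) n :
  \sum_(j < n.+1) \sum_(i < j.+1) G i (j - i)%N (n - j)%N =
  \sum_(i < n.+1) \sum_(j < (n - i).+1) G i j (n - i - j)%N.
Proof.
pose H j i := G i (j - i)%N (n - j)%N.
rewrite -(big_mkord xpredT (fun j => \sum_(i < j.+1) H j i)).
under eq_big_nat => j /andP[_ jn].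
  rewrite -(big_mkord xpredT (H j)) (big_nat_widen _ _ n.+1) //.
  over.
rewrite /= (exchange_big_dep_nat xpredT) //= big_mkord; apply: eq_bigr => i _.
under eq_bigl => j do rewrite ltnS.
rewrite -(big_nat_widenl i 0 n.+1 xpredT) // -{1}[nat_of_ord i]add0n big_addn.
rewrite subSn ?leq_ord // big_mkord; apply: eq_bigr => j _.
by rewrite /H addnK -subnDA addnC.
Qed.

Section HserRing.
Variable A : comNzRingType.
Implicit Types x y z : hser A.

Definition hser_mul x y :=
  HSer (fun n => \sum_(i < n.+1) hcoef x i * hcoef y (n - i)%N).
Definition hser_one : hser A := HSer (fun n => (n == 0%N)%:R).

Lemma hser_mulA : associative hser_mul.
Proof.
move=> x y z; apply: hserP => n /=.
under eq_bigr do rewrite big_distrr /=.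
under [RHS]eq_bigr do rewrite big_distrl /=.
rewrite (triangle_sum (fun i j k => hcoef x i * hcoef y j * hcoef z k)).
by apply: eq_bigr => i _; apply: eq_bigr => j _; rewrite mulrA.
Qed.

Lemma hser_mulC : commutative hser_mul.
Proof.
move=> x y; apply: hserP => n /=; rewrite [LHS](reindex_inj rev_ord_inj) /=.
by apply: eq_bigr => i _; rewrite subSS subKn ?leq_ord // mulrC.
Qed.

Lemma hser_mul1 : left_id hser_one hser_mul.
Proof.
move=> x; apply: hserP => n /=; rewrite big_ord_recl /= mul1r subn0.
by rewrite big1 ?addr0 // => i _; rewrite mul0r.
Qed.

Lemma hser_mulDl : left_distributive hser_mul +%R.
Proof.
move=> x y z; apply: hserP => n /=; rewrite -big_split /=.
by apply: eq_bigr => i _; rewrite mulrDl.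
Qed.

Lemma hser_one_neq0 : hser_one != 0.
Proof.
by apply/eqP => /(congr1 (fun x => hcoef x 0)) /= /eqP; rewrite oner_eq0.
Qed.

HB.instance Definition _ := GRing.Zmodule_isComNzRing.Build (hser A)
  hser_mulA hser_mulC hser_mul1 hser_mulDl hser_one_neq0.

Definition hX : hser A := HSer (fun n => (n == 1%N)%:R).

End HserRing.

Section HserModule.
Variables (F : comNzRingType) (A : lmodType F).
Implicit Types (c d : hser F) (x y : hser A).

Definition hser_scale c x : hser A :=
  HSer (fun n => \sum_(i < n.+1) hcoef c i *: hcoef x (n - i)%N).

Lemma hser_scaleA c d x : hser_scale c (hser_scale d x) = hser_scale (c * d) x.
Proof.
apply: hserP => n /=.
under eq_bigr do rewrite scaler_sumr.
under [RHS]eq_bigr do rewrite scaler_suml.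
rewrite (triangle_sum (fun i j k => (hcoef c i * hcoef d j) *: hcoef x k)).
by apply: eq_bigr => i _; apply: eq_bigr => j _; rewrite scalerA.
Qed.

Lemma hser_scale1 : left_id 1 hser_scale.
Proof.
move=> x; apply: hserP => n /=; rewrite big_ord_recl /= scale1r subn0.
by rewrite big1 ?addr0 // => i _; rewrite scale0r.
Qed.

Lemma hser_scaleDr : right_distributive hser_scale +%R.
Proof.
move=> c x y; apply: hserP => n /=; rewrite -big_split /=.
by apply: eq_bigr => i _; rewrite scalerDr.
Qed.

Lemma hser_scaleDl x : {morph hser_scale^~ x : c d / c + d}.
Proof.
move=> c d; apply: hserP => n /=; rewrite -big_split /=.
by apply: eq_bigr => i _; rewrite scalerDl.
Qed.

HB.instance Definition _ := GRing.Zmodule_isLmodule.Build (hser F) (hser A)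
  hser_scaleA hser_scale1 hser_scaleDr hser_scaleDl.

Lemma hcoefZ c x n :
  hcoef (c *: x) n = \sum_(i < n.+1) hcoef c i *: hcoef x (n - i)%N.
Proof. by []. Qed.

Lemma hcoefXZ x n :
  hcoef (hX F *: x) n = if n is m.+1 then hcoef x m else 0.
Proof.
rewrite hcoefZ; case: n => [|n]; first by rewrite big_ord1 scale0r.
rewrite !big_ord_recl /= scale0r add0r scale1r subSS subn0.
by rewrite big1 ?addr0 // => i _; rewrite scale0r.
Qed.

Definition hideal n : set (hser A) := [set x | exists y, x = hX F ^+ n *: y].

Lemma hidealP n x : hideal n x <-> forall k, (k < n)%N -> hcoef x k = 0.
Proof.
split=> [[y ->] {x}|].
  elim: n y => [|n IH] y k //; rewrite exprS -scalerA hcoefXZ.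
  by case: k => // k kn; exact: IH.
elim: n x => [|n IH] x xn; first by exists x; rewrite scale1r.
have [k kn|y xy] := IH (HSer (fun k => hcoef x k.+1)); first exact: xn.
exists y; rewrite exprS -scalerA -xy; apply: hserP => k; rewrite hcoefXZ.
by case: k => //; rewrite xn.
Qed.

Definition hcst (a : A) : hser A := HSer (fun n => if n is 0 then a else 0).

Lemma hser_eta x : x = hcst (hcoef x 0) + hX F *: HSer (fun n => hcoef x n.+1).
Proof.
by apply: hserP => n; rewrite hcoefD hcoefXZ; case: n => [|n] /=;
  rewrite ?addr0 ?add0r.
Qed.

Lemma hcstD a b : hcst (a + b) = hcst a + hcst b.
Proof. by apply: hserP => -[|n] //=; rewrite addr0. Qed.

Lemma hcstZ k a :
  hcst (k *: a) = (HSer (fun n => if n is 0 then k else 0)) *: hcst a.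
Proof.
apply: hserP => n; rewrite hcoefZ big_ord_recl /= subn0 big1 ?addr0.
  by case: n => //= n; rewrite scaler0.
by move=> i _; rewrite scale0r.
Qed.

End HserModule.

Lemma hcoef_linear (F : comNzRingType) (A W : lmodType F)
    (g : hser A -> hser W) x n :
    (forall x y, g (x + y) = g x + g y) ->
    (forall (c : hser F) x, g (c *: x) = c *: g x) ->
  hcoef (g x) n = \sum_(k < n.+1) hcoef (g (hcst (hcoef x k))) (n - k)%N.
Proof.
move=> gD gZ.
elim: n x => [|n IH] x; rewrite {1}(hser_eta x) gD gZ hcoefD hcoefXZ.
  by rewrite big_ord1 addr0.
by rewrite IH [RHS]big_ord_recl.
Qed.

(* The sum of an h-adically summable family: modulo each power of h only      *)
(* finitely many terms are nonzero, so each coefficient is a finite sum. (The *)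
(* library's [\sum_(i \in _)] returns 0 on an infinite support.)              *)
Definition hsum (I : choiceType) (A : zmodType) (f : I -> hser A) : hser A :=
  HSer (fun n => \sum_(i \in [set: I]) hcoef (f i) n).

Definition hbilinear (F : comNzRingType) (A B W : lmodType F)
    (f : hser A -> hser B -> hser W) : Prop :=
  [/\ forall x x' y, f (x + x') y = f x y + f x' y,
      forall x y y', f x (y + y') = f x y + f x y',
      forall (c : hser F) x y, f (c *: x) y = c *: f x y &
      forall (c : hser F) x y, f x (c *: y) = c *: f x y].

Section CompletedTensor.
Variables (F : comNzRingType) (A B : lmodType F).

Definition hpure (x : hser A) (y : hser B) : hser (tensor A B) :=
  HSer (fun n => \sum_(i < n.+1) pure (hcoef x i) (hcoef y (n - i)%N)).

Lemma hpure_bilinear : hbilinear hpure.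
Proof.
split=> [x x' y|x y y'|c x y|c x y]; apply: hserP => n /=.
- by rewrite -big_split; apply: eq_bigr => i _; rewrite pureDl.
- by rewrite -big_split; apply: eq_bigr => i _; rewrite pureDr.
- under eq_bigr do rewrite pure_suml.
  under [RHS]eq_bigr do rewrite scaler_sumr.
  rewrite (triangle_sum (fun i j k =>
    pure (hcoef c i *: hcoef x j) (hcoef y k))).
  by apply: eq_bigr => i _; apply: eq_bigr => j _; rewrite pureZl.
- under eq_bigr do rewrite pure_sumr.
  under [RHS]eq_bigr do rewrite scaler_sumr.
  rewrite -(triangle_sum (fun i j k =>
    hcoef c i *: pure (hcoef x j) (hcoef y k))).
  rewrite -(triangle_sum (fun i j k =>
    pure (hcoef x i) (hcoef c j *: hcoef y k))).
  apply: eq_bigr => i _; rewrite [LHS](reindex_inj rev_ord_inj) /=.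
  by apply: eq_bigr => j _; rewrite subSS subKn ?leq_ord // pureZr.
Qed.

(* The map on the completed tensor product induced by a C[[h]]-bilinear f;    *)
(* see [hlift_pure] and [hlift_linear].                                       *)
Definition hlift (W : lmodType F) (f : hser A -> hser B -> hser W)
    (t : hser (tensor A B)) : hser W :=
  HSer (fun n => \sum_(i < n.+1)
    tlift (fun a b => hcoef (f (hcst a) (hcst b)) (n - i)%N) (hcoef t i)).

End CompletedTensor.

Section HliftTheory.
Variables (F : comNzRingType) (A B W : lmodType F).
Implicit Types f : hser A -> hser B -> hser W.

Lemma tlift_hbilinear f m (s : seq (A * B)) : hbilinear f ->
  tlift (fun a b => hcoef (f (hcst a) (hcst b)) m) (tens_sum s) =
  \sum_(p <- s) hcoef (f (hcst p.1) (hcst p.2)) m.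
Proof.
move=> [fDl fDr fZl fZr]; rewrite tlift_sum //.
- by move=> a a' b; rewrite hcstD fDl.
- by move=> a b b'; rewrite hcstD fDr.
- by move=> k a b; rewrite !hcstZ fZl fZr.
Qed.

Lemma hlift_pure f x y : hbilinear f -> hlift f (hpure x y) = f x y.
Proof.
move=> fbil; have [fDl fDr fZl fZr] := fbil; apply: hserP => n /=.
rewrite (hcoef_linear (g := f^~ y)) //.
under [RHS]eq_bigr do rewrite (hcoef_linear (g := f _)) //.
rewrite -(triangle_sum (fun k l m =>
  hcoef (f (hcst (hcoef x k)) (hcst (hcoef y l))) m)).
apply: eq_bigr => i _.
rewrite -(big_map (fun k : 'I_i.+1 => (hcoef x k, hcoef y (i - k)%N)) xpredT
  (fun p => pure p.1 p.2)) -tens_sumE.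
by rewrite tlift_hbilinear // big_map.
Qed.

Lemma hlift_linear f : hbilinear f -> linear (hlift f).
Proof.
move=> fbil; have [fDl fDr fZl fZr] := fbil => c t t'.
pose g m := tlift (fun a b => hcoef (f (hcst a) (hcst b)) m).
have gD m u v : g m (u + v) = g m u + g m v.
  by elim/tensW: u => u; elim/tensW: v => v;
    rewrite tens_sumD /g !tlift_hbilinear // big_cat.
have gZ m k u : g m (k *: u) = k *: g m u.
  elim/tensW: u => u; rewrite tens_sumZ /g !tlift_hbilinear // big_map.
  rewrite scaler_sumr; apply: eq_bigr => -[a b] _ /=.
  rewrite hcstZ fZl hcoefZ big_ord_recl /= subn0 big1 ?addr0 // => i _.
  by rewrite scale0r.
have g0 m : g m 0 = 0 by rewrite -(scale0r 0) gZ scale0r.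
apply: hserP => n /=.
under eq_bigr => i _.
  rewrite -/(g _) gD (big_morph (g _) (gD _) (g0 _)).
  under eq_bigr do rewrite gZ.
  over.
rewrite big_split /=; congr (_ + _).
under [RHS]eq_bigr do rewrite scaler_sumr.
by rewrite (triangle_sum (fun i j k => hcoef c i *: g k (hcoef t j))).
Qed.

Lemma hlift_addf f f' t :
  hlift (fun x y => f x y + f' x y) t = hlift f t + hlift f' t.
Proof.
apply: hserP => n /=; rewrite -big_split; apply: eq_bigr => i _.
by rewrite /tlift -big_split.
Qed.

Lemma hlift_scalef (c : hser F) f t :
  hlift (fun x y => c *: f x y) t = c *: hlift f t.
Proof.
apply: hserP => n /=; under [RHS]eq_bigr do rewrite scaler_sumr.
pose g j k := tlift (fun a b => hcoef (f (hcst a) (hcst b)) k) (hcoef t j).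
rewrite -(triangle_sum (fun i j k => hcoef c i *: g j k)).
under [RHS]eq_bigr => j _.
  rewrite (reindex_inj rev_ord_inj) /=.
  under eq_bigr => i _ do rewrite subSS subKn ?leq_ord //.
  over.
rewrite (triangle_sum (fun i j k => hcoef c j *: g i k)).
apply: eq_bigr => i _; rewrite /g /tlift.
rewrite exchange_big; apply: eq_bigr => j _ /=.
by rewrite scaler_sumr.
Qed.

End HliftTheory.

Definition hlift3 (F : comNzRingType) (A B C W : lmodType F)
    (f : hser A -> hser B -> hser C -> hser W) :
    hser (tensor (tensor A B) C) -> hser W :=
  hlift (fun ab c => hlift (fun a b => f a b c) ab).

Lemma hlift3_pure (F : comNzRingType) (A B C W : lmodType F)
    (f : hser A -> hser B -> hser C -> hser W) x y z :
    (forall z, hbilinear (fun x y => f x y z)) ->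
    (forall x y, linear (f x y)) ->
  hlift3 f (hpure (hpure x y) z) = f x y z.
Proof.
move=> fbil flin; rewrite /hlift3 hlift_pure ?hlift_pure //.
split=> [t t' w|t w w'|c t w|c t w].
- by have := hlift_linear (fbil w) 1 t t'; rewrite !scale1r.
- rewrite -hlift_addf; congr hlift; apply/funext => a; apply/funext => b.
  by have := flin a b 1 w w'; rewrite !scale1r.
- have := hlift_linear (fbil w); set g := hlift _ => glin.
  have g0 : g 0 = 0.
    by apply: (addrI (g 0)); have := glin 1 0 0; rewrite !scale1r !addr0.
  by have := glin c t 0; rewrite !addr0 g0 addr0.
- rewrite -hlift_scalef; congr hlift; apply/funext => a; apply/funext => b.
  have f0 : f a b 0 = 0.
    by apply: (addrI (f a b 0)); have := flin a b 1 0 0; rewrite !scale1r !addr0.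
  by have := flin a b c w 0; rewrite !addr0 f0 addr0.
Qed.

(* The vector space F((z)). *)
Section Laurent.
Variable F : fieldType.

Definition laurent_pred : {pred int -> F^o} :=
  fun f => `[< exists N : int, forall n, (n < N)%R -> f n = 0 >].

Lemma laurent_submod_closed : submod_closed laurent_pred.
Proof.
split=> [|k f g /asboolP[N fN] /asboolP[M gM]]; apply/asboolP.
  by exists 0.
exists (Order.min N M) => n; rewrite lt_min => /andP[nN nM].
have -> : (k *: f + g) n = k *: f n + g n by [].
by rewrite fN // gM // scaler0 addr0.
Qed.

HB.instance Definition _ :=
  GRing.isSubmodClosed.Build F (int -> F^o) laurent_pred laurent_submod_closed.

Record laurent := Laurent {
  lcoef : int -> F^o;
  laurentP : lcoef \in laurent_pred }.

HB.instance Definition _ := [isSub for lcoef].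
HB.instance Definition _ := [Choice of laurent by <:].
HB.instance Definition _ := [SubChoice_isSubLmodule of laurent by <:].

End Laurent.

(* The image of (x, y) in the h-adically completed product of A[[h]], B[[h]]. *)
Infix "⊗" := hpure (at level 40, left associativity) : ring_scope.

(* Formal series in z are functions [X : int -> _], [X n] being the           *)
(* coefficient of z^n; formal series in two variables z1, z2 (or z0, z2) are  *)
(* functions [X : int -> int -> _], [X p q] being the coefficient of          *)
(* z1^p z2^q.                                                                 *)
Section FormalSeries.

(* The binomial coefficient n(n-1)...(n-j+1)/j! for an integer n; [Negz m] is *)
(* -(m+1).                                                                    *)
Definition binz (n : int) (j : nat) : int :=
  match n with
  | Posz m => 'C(m, j)%:Z
  | Negz m => (-1) ^+ j * 'C(m + j, j)%:Z
  end.

Definition deriv_ser (A : zmodType) (X : int -> A) : int -> A :=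
  fun n => X (n + 1) *~ (n + 1).

(* X(z1 + e z2), expanded in nonnegative powers of z2.                        *)
Definition subst_bin (A : zmodType) (e : int) (X : int -> A) :
    int -> int -> A :=
  fun p q => if q is Posz j then X (p + j%:Z) *~ (e ^+ j * binz (p + j%:Z) j)
             else 0.

(* (z1 + e z2) X(z1, z2).                                                     *)
Definition mul_bin (A : zmodType) (e : int) (X : int -> int -> A) :
    int -> int -> A :=
  fun p q => X (p - 1) q + X p (q - 1) *~ e.

(* X(z0 + z2, z2), expanded in nonnegative powers of z2; the sum over j is    *)
(* h-adically convergent as soon as, modulo each h^n, the exponents of z2 in  *)
(* X are bounded below.                                                       *)
Definition subst_assoc (A : zmodType) (X : int -> int -> hser A) :
    int -> int -> hser A :=
  fun p q => hsum (fun j : nat =>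
    X (p + j%:Z) (q - j%:Z) *~ binz (p + j%:Z) j).

(* Products of operator-valued formal series.                                 *)
Definition ser_comp (A : zmodType) (X Y : int -> hser A -> hser A) :
    int -> hser A -> hser A :=
  fun n t => hsum (fun i : int => X i (Y (n - i) t)).

Definition ser2_comp (A : zmodType) (X Y : int -> int -> hser A -> hser A) :
    int -> int -> hser A -> hser A :=
  fun p q t => hsum (fun ij : int * int =>
    X ij.1 ij.2 (Y (p - ij.1) (q - ij.2) t)).

(* X(z1) and X(z2), as series in z1, z2.                                      *)
Definition in_z1 (A : zmodType) (X : int -> A) : int -> int -> A :=
  fun p q => if q == 0 then X p else 0.
Definition in_z2 (A : zmodType) (X : int -> A) : int -> int -> A :=
  fun p q => if p == 0 then X q else 0.

End FormalSeries.

Section QuantumVertexAlgebra.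
Variables (F : fieldType) (V0 : lmodType F).

(* V = V0[[h]], and the completed products V ⊗ V, (V ⊗ V) ⊗ V and             *)
(* V ⊗ V ⊗ C((z)); the base field F stands for C.                             *)
Local Notation V := (hser V0).
Local Notation VV := (hser (tensor V0 V0)).
Local Notation VVV := (hser (tensor (tensor V0 V0) V0)).
Local Notation VVz := (hser (tensor (tensor V0 V0) (laurent F))).

(* The coefficient of z^n of an element of V ⊗ V ⊗ C((z)).                    *)
Definition zcoef (x : VVz) (n : int) : VV :=
  hlift (fun (t : VV) (f : hser (laurent F)) =>
    (HSer (fun k => lcoef (hcoef f k) n) : hser F) *: t) x.

Definition hflip : VV -> VV := hlift (fun a b : V => b ⊗ a).

Definition op12 (X : VV -> VV) : VVV -> VVV :=
  hlift (fun (ab : VV) (c : V) => X ab ⊗ c).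

Definition op23 (X : VV -> VV) : VVV -> VVV :=
  hlift3 (fun a b c : V =>
    hlift (fun b' c' : V => a ⊗ b' ⊗ c') (X (b ⊗ c))).

Definition op13 (X : VV -> VV) : VVV -> VVV :=
  hlift3 (fun a b c : V =>
    hlift (fun a' c' : V => a' ⊗ b ⊗ c') (X (a ⊗ c))).

Section Fields.
Variables (Y : VV -> int -> V) (S : VV -> VVz).

(* Y(z1)(1 ⊗ Y(z2)) x.                                                        *)
Definition iterY (x : VVV) : int -> int -> V :=
  fun p q => Y (hlift3 (fun a b c : V => a ⊗ Y (b ⊗ c) q) x) p.

(* Y(z1)(1 ⊗ Y(z2)) (S(z1 - z2)t ⊗ u): product of the operator-valued series  *)
(* Y(z1)(1 ⊗ Y(z2)) and the series S(z1 - z2)t ⊗ u. Modulo h^n, S(z)t is a    *)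
(* finite sum of a ⊗ b ⊗ f(z), f in C((z)), and S(z1 - z2)t has only          *)
(* nonnegative powers of z2; hence the sum is h-adically convergent.          *)
Definition iterYS (t : VV) (u : V) : int -> int -> V :=
  fun p q => hsum (fun ij : int * int =>
    iterY (subst_bin (-1) (zcoef (S t)) ij.1 ij.2 ⊗ u)
      (p - ij.1) (q - ij.2)).

(* Y(z2)(1 ⊗ Y(z1)) x.                                                        *)
Definition iterY21 (x : VVV) : int -> int -> V := fun p q => iterY x q p.

(* S(z), S(-z) and S_21(z), as series of operators on V ⊗ V.                  *)
Definition Sop : int -> VV -> VV := fun n t => zcoef (S t) n.
Definition Sop_neg : int -> VV -> VV := fun n t => Sop n t *~ (-1) ^+ `|n|%N.
Definition Sop21 : int -> VV -> VV := fun n t => hflip (Sop n (hflip t)).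

(* S_12(z1), S_13(z1 + z2), S_23(z2).                                         *)
Definition S12 : int -> int -> VVV -> VVV := in_z1 (fun n => op12 (Sop n)).
Definition S13 : int -> int -> VVV -> VVV :=
  subst_bin 1 (fun n => op13 (Sop n)).
Definition S23 : int -> int -> VVV -> VVV := in_z2 (fun n => op23 (Sop n)).

Definition weak_associativity : Prop :=
  forall (u v w : V) (n : nat), exists l : nat, forall p q : int,
    hideal n
      (iter l (mul_bin 1)
         (subst_assoc (fun p q => Y (v ⊗ Y (w ⊗ u) q) p)) p q -
       iter l (mul_bin 1) (fun p q => Y (Y (v ⊗ w) p ⊗ u) q) p q).

Definition S_locality : Prop :=
  forall (v w : V) (n : nat), exists l : nat, forall (u : V) (p q : int),
    hideal n
      (iter l (mul_bin (-1)) (iterYS (v ⊗ w) u) p q -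
       iter l (mul_bin (-1)) (iterY21 (w ⊗ v ⊗ u)) p q).

End Fields.

Record quantumVertexAlgebra := QuantumVertexAlgebra {
  qva_Y : {linear VV -> (int -> V)};
  qva_vac : V;
  qva_D : {linear V -> V};
  qva_S : {linear VV -> VVz};
  (* Y takes values in V_h((z)); v_r w is the coefficient of z^(-r-1).        *)
  qva_Y_trunc : forall (t : VV) (n : nat), exists N : int, forall r : int,
    (N <= r)%R -> hideal n (qva_Y t (- r - 1));
  qva_assoc : weak_associativity qva_Y;
  qva_vacl : forall (v : V) (n : int),
    qva_Y (qva_vac ⊗ v) n = if n == 0 then v else 0;
  qva_vacr : forall v : V, (forall n : int, (n < 0)%R ->
    qva_Y (v ⊗ qva_vac) n = 0) /\ qva_Y (v ⊗ qva_vac) 0 = v;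
  qva_D_vac : qva_D qva_vac = 0;
  qva_Y_deriv : forall (v w : V) (n : int),
    deriv_ser (qva_Y (v ⊗ w)) n =
      qva_D (qva_Y (v ⊗ w) n) - qva_Y (v ⊗ qva_D w) n;
  (* D ⊗ 1 does not act on the factor C((z)), hence commutes with [zcoef].    *)
  qva_S_deriv : forall (t : VV) (n : int),
    let D1 := hlift (fun a b : V => qva_D a ⊗ b) in
    D1 (Sop qva_S n t) - Sop qva_S n (D1 t) =
      - deriv_ser (fun m => Sop qva_S m t) n;
  qva_YBE :
    ser2_comp (S12 qva_S) (ser2_comp (S13 qva_S) (S23 qva_S)) =
    ser2_comp (S23 qva_S) (ser2_comp (S13 qva_S) (S12 qva_S));
  (* S_21(z) is the inverse of S(-z).                                         *)
  qva_S_unitary :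
    let id_ser := fun (n : int) (t : VV) => if n == 0 then t else 0 in
    ser_comp (Sop21 qva_S) (Sop_neg qva_S) = id_ser /\
    ser_comp (Sop_neg qva_S) (Sop21 qva_S) = id_ser;
  qva_locality : S_locality qva_Y qva_S
}.

Definition rprod (Q : quantumVertexAlgebra) (v : V) (r : int) (w : V) : V :=
  qva_Y Q (v ⊗ w) (- r - 1).

Definition center (Q : quantumVertexAlgebra) : set V :=
  [set v | forall (w : V) (r : int), (0 <= r)%R -> rprod Q w r v = 0].

Lemma zcoef_pure (t : VV) (f : hser (laurent F)) (n : int) :
  zcoef (t ⊗ f) n = (HSer (fun k => lcoef (hcoef f k) n) : hser F) *: t.
Proof.
rewrite /zcoef hlift_pure //; split=> [t1 t2 g|t1 g g'|c t1 g|c t1 g].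
- by rewrite scalerDr.
- by rewrite -scalerDl; congr (_ *: _); apply: hserP.
- by rewrite !scalerA mulrC.
rewrite scalerA; congr (_ *: _); apply: hserP => k /=.
rewrite -[LHS]/((fun h : laurent F => (lcoef h n : F)) _).
have lD : {morph (fun h : laurent F => lcoef h n : F) : x y / x + y} by [].
by rewrite (big_morph _ lD (erefl _)).
Qed.

Lemma iterY_pure (Y : {linear VV -> (int -> V)}) (a b c : V) (p q : int) :
  iterY Y (a ⊗ b ⊗ c) p q = Y (a ⊗ Y (b ⊗ c) q) p.
Proof.
have [tDl tDr tZl tZr] := hpure_bilinear V0 V0.
rewrite /iterY hlift3_pure // => [z|x y].
  split=> [x x' y|x y y'|k x y|k x y]; rewrite ?tDl ?tZl //.
    by rewrite linearD /= tDr.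
  by rewrite linearZ /= tZr.
by move=> k z z'; rewrite tDr tZr linearP /= tDr tZr.
Qed.

End QuantumVertexAlgebra.

(* Main.v *)
Require Import Defs.
From HB Require Import structures.
From mathcomp Require Import all_boot all_order all_algebra.
From mathcomp Require Import boolp classical_sets reals complex.
From mathcomp Require Import fsbigop zify.

Set Implicit Arguments.
Unset Strict Implicit.
Unset Printing Implicit Defensive.

Local Open Scope ring_scope.
Local Open Scope complex_scope.

(** Work modulo h^n. Multiplication by z1 - z2 is injective on series in which
    the exponents of z2 are bounded below, so by S-locality it is enough to
    bound the exponents of z2 on both sides. On the left they are nonnegative,
    since u is central and S(z1 - z2) is expanded in powers of z2. On the right,
    let X(z1, z2) = Y(w, z1)Y(v, z2)u. As v and u are central, Y(Y(w, z0)v, z2)u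
    has no negative power of z0, so by weak associativity neither does
    (z0 + z2)^l X(z0 + z2, z2). As X has no negative power of z2, this forces
    z1^l X(z1, z2) to have no negative power of z1. *)

Import GRing.Theory Num.Theory Order.TTheory.

(** The index comes first so that [hcoefn n] can carry an additive structure and [raddf_sum]
    applies. *)
Definition hcoefn (A : zmodType) n (x : hser A) := hcoef x n.

Lemma hcoefn_is_zmod_morphism (A : zmodType) n : zmod_morphism (@hcoefn A n).
Proof. by []. Qed.

HB.instance Definition _ (A : zmodType) n :=
  GRing.isZmodMorphism.Build (hser A) A (@hcoefn A n)
    (@hcoefn_is_zmod_morphism A n).

Lemma hsum_eq0 (I : choiceType) (A : zmodType) (f : I -> hser A) :
  (forall i, f i = 0) -> hsum f = 0.
Proof.
by move=> f0; apply: hserP => n /=; rewrite fsbig1 // => i _; rewrite f0.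
Qed.

Lemma hsum_ord (A : zmodType) N (f : nat -> hser A) :
  (forall j, (N <= j)%N -> f j = 0) -> hsum f = \sum_(j < N) f j.
Proof.
move=> fN; apply: hserP => n /=; rewrite -[RHS]/(hcoefn n _) raddf_sum.
rewrite (fsbig_ord _ _ (fun j => hcoefn n (f j))); apply/esym/fsbig_widen => //.
by move=> j [_ /negP]; rewrite -leqNgt => /fN /= ->.
Qed.

Lemma binz0 n : binz n 0 = 1.
Proof. by case: n => m; rewrite /= ?addn0 bin0 ?mulr1. Qed.

Lemma binzS n j : binz (n + 1) j.+1 = binz n j.+1 + binz n j.
Proof.
case: n => [m|[|m]].
- by rewrite -PoszD addn1 /= binS PoszD.
(* The case n = -1 is the only one where [n] and [n + 1] fall under different clauses of [binz]. *)
- rewrite [LHS]/= bin0n /= !add0n !binn !mulr1 exprS mulN1r.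
  exact/esym/addNr.
- rewrite [Negz m.+1 + 1](_ : _ = Negz m); last by lia.
  rewrite /= !addSn !addnS [in RHS]binS PoszD mulrDr -addrA -[LHS]addr0.
  by congr (_ + _); rewrite exprS mulN1r mulNr; exact/esym/addNr.
Qed.

Lemma mul_bin_raddf (A B : zmodType) (f : {additive A -> B}) e X l p q :
  f (iter l (mul_bin e) X p q) = iter l (mul_bin e) (fun p q => f (X p q)) p q.
Proof.
elim: l p q => //= l IH p q.
by rewrite /mul_bin raddfD /= raddfMz !IH.
Qed.

Lemma mul_binB (A : zmodType) e (X Y : int -> int -> A) l p q :
  iter l (mul_bin e) (fun p q => X p q - Y p q) p q =
  iter l (mul_bin e) X p q - iter l (mul_bin e) Y p q.
Proof.
elim: l p q => //= l IH p q.
by rewrite /mul_bin !IH mulrzBl opprD addrACA.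
Qed.

Lemma mul_bin_low (A : zmodType) e (N : int) l (X : int -> int -> A) :
    (forall p q : int, p < N -> X p q = 0) ->
  forall p q : int, p < N -> iter l (mul_bin e) X p q = 0.
Proof.
move=> XN; elim: l => //= l IH p q pN.
by rewrite /mul_bin !IH ?mul0rz ?addr0 //; lia.
Qed.

(** The lowest power of z2 in the product comes only from z1 times the lowest power in X, which must
    then vanish; one continues upwards in z2. *)
Lemma mul_bin_inj (A : zmodType) e (N : int) l (X : int -> int -> A) :
    (forall p q : int, q < N -> X p q = 0) ->
    (forall p q, iter l (mul_bin e) X p q = 0) ->
  forall p q, X p q = 0.
Proof.
elim: l X => // l IH X XN X0.
have {X0} {}IH p q : mul_bin e X p q = 0.
  apply: IH p q => p q; last by rewrite -iterSr.
  by move=> qN; rewrite /mul_bin !XN ?mul0rz ?addr0 //; lia.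
suff Xm (m : nat) (p q : int) : q < N + m%:Z -> X p q = 0.
  by move=> p q; apply: (Xm (absz (q - N + 1)) p q); lia.
elim: m p q => [|m IHm] p q qN; first by rewrite XN //; lia.
have := IH (p + 1) q; rewrite /mul_bin addrK (IHm _ (q - 1)) ?mul0rz ?addr0 //.
by lia.
Qed.

Section SubstAssoc.
Variable A : zmodType.
Implicit Types X : int -> int -> hser A.

(** The cutoff is free above [q], so that sums at different exponents can be given matching
    lengths. *)
Lemma subst_assoc_ord N X p q :
    (forall a b : int, b < 0 -> X a b = 0) -> q < N%:Z ->
  subst_assoc X p q = \sum_(j < N) X (p + j%:Z) (q - j%:Z) *~ binz (p + j%:Z) j.
Proof. by move=> X0 qN; apply: hsum_ord => j Nj; rewrite X0 ?mul0rz //; lia. Qed.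

(** By Pascal's rule [binzS]: substituting z1 = z0 + z2 turns multiplication by z1 into
    multiplication by z0 + z2. *)
Lemma mul_bin_subst_assoc X p q : (forall a b : int, b < 0 -> X a b = 0) ->
  mul_bin 1 (subst_assoc X) p q = subst_assoc (fun a b => X (a - 1) b) p q.
Proof.
move=> X0; pose N := `|q|%N.
(* The sum at [q - 1] gets one term fewer: it pairs with what is left of the other two after their
   terms j = 0 are matched. *)
rewrite /mul_bin (@subst_assoc_ord N.+2) //; last by lia.
rewrite (@subst_assoc_ord N.+1) // ?(@subst_assoc_ord N.+2); try lia; last first.
  by move=> a b; exact: X0.
rewrite big_ord_recl [in RHS]big_ord_recl !binz0 !addr0 -addrA; congr (_ + _).
rewrite mulrz_suml -big_split; apply: eq_bigr => i _ /=.
rewrite /bump leq0n add1n mulr1z.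
have -> : p - 1 + i.+1%:Z = p + i%:Z by lia.
have -> : p + i.+1%:Z - 1 = p + i%:Z by lia.
have -> : q - 1 - i%:Z = q - i.+1%:Z by lia.
have -> : p + i.+1%:Z = p + i%:Z + 1 by lia.
by rewrite binzS mulrzDr.
Qed.

Lemma iter_mul_bin_subst_assoc l X p q :
    (forall a b : int, b < 0 -> X a b = 0) ->
  iter l (mul_bin 1) (subst_assoc X) p q =
  subst_assoc (fun a b => X (a - l%:Z) b) p q.
Proof.
move=> X0; elim: l p q => [|l IH] p q.
  congr (subst_assoc _ p q).
  by apply/funext => a; apply/funext => b; rewrite subr0.
have {}IH : iter l (mul_bin 1) (subst_assoc X) =
    subst_assoc (fun a b => X (a - l%:Z) b).
  by apply/funext => a; apply/funext => b.
rewrite iterS IH mul_bin_subst_assoc => [|a b]; last exact: X0.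
congr (subst_assoc _ p q).
by apply/funext => a; apply/funext => b; congr X; lia.
Qed.

(** The substitution is triangular in the exponent of z2: it adds to the coefficient at (a, b) only
    multiples of those at (a + j, b - j) with j > 0, so induction on b applies. *)
Lemma subst_assoc_low X n :
    (forall a b : int, b < 0 -> X a b = 0) ->
    (forall p q : int, p < 0 -> hcoef (subst_assoc X p q) n = 0) ->
  forall a b : int, a < 0 -> hcoef (X a b) n = 0.
Proof.
move=> X0 sX0.
suff Xm (m : nat) (a b : int) : a < 0 -> b < m%:Z -> hcoef (X a b) n = 0.
  by move=> a b a0; apply: (Xm (absz (b + 1))); lia.
elim: m a b => [|m IH] a b a0 bm; first by rewrite X0.
have := sX0 a b a0; rewrite (@subst_assoc_ord m.+1) // -/(hcoefn n _) raddf_sum.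
rewrite big_ord_recl addr0 subr0 binz0 mulr1z [X in _ + X]big1 ?addr0 //.
move=> i _ /=; rewrite raddfMz /= /bump leq0n add1n.
have [ai0|ai0] := ltP (a + i.+1%:Z) 0.
  by rewrite /hcoefn IH ?mul0rz //; lia.
(* The binomial coefficient C(a + j, j) vanishes as 0 <= a + j < j. *)
have [k kE] : exists k : nat, a + i.+1%:Z = k%:Z :> int.
  by exists (absz (a + i.+1%:Z)); lia.
by rewrite kE /binz bin_small //; lia.
Qed.

End SubstAssoc.

(** Serves the coefficients of S(z1 - z2)(v ⊗ w), which need not be pure tensors as [hlift3_pure]
    requires. *)
Lemma hlift3_purel (F : comNzRingType) (A B C W : lmodType F)
    (f : hser A -> hser B -> hser C -> hser W) t z :
    (forall z, hbilinear (fun x y => f x y z)) ->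
    (forall x y, linear (f x y)) ->
  hlift3 f (t ⊗ z) = hlift (fun x y => f x y z) t.
Proof.
move=> fbil flin; rewrite /hlift3 hlift_pure //.
have fD x y c c' : f x y (c + c') = f x y c + f x y c'.
  by have := flin x y 1 c c'; rewrite !scale1r.
have f0 x y : f x y 0 = 0 by apply: (addrI (f x y 0)); rewrite -fD !addr0.
have hD c s s' : hlift (fun x y => f x y c) (s + s') =
    hlift (fun x y => f x y c) s + hlift (fun x y => f x y c) s'.
  by have := hlift_linear (fbil c) 1 s s'; rewrite !scale1r.
split=> [s s' c|s c c'|k s c|k s c]; first exact: hD.
- rewrite -hlift_addf; congr hlift.
  by apply/funext => x; apply/funext => y; exact: fD.
- have := hlift_linear (fbil c) k s 0; set h := hlift _.
  by rewrite addr0 => ->; rewrite (_ : h 0 = 0) ?addr0 //;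
    apply: (addrI (h 0)); rewrite -hD !addr0.
- rewrite -hlift_scalef; congr hlift.
  apply/funext => x; apply/funext => y.
  by have := flin x y k c 0; rewrite f0 !addr0.
Qed.

Lemma hlift0f (F : comNzRingType) (A B W : lmodType F) (t : hser (tensor A B)) :
  hlift (fun _ _ => 0 : hser W) t = 0.
Proof. by apply: hserP => n /=; rewrite big1 // => i _; exact: big1. Qed.

Lemma hpure0l (F : comNzRingType) (A B : lmodType F) (y : hser B) :
  (0 : hser A) ⊗ y = 0.
Proof.
have [tDl _ _ _] := hpure_bilinear A B.
by apply: (addrI (0 ⊗ y)); rewrite -tDl !addr0.
Qed.

Lemma hpure0r (F : comNzRingType) (A B : lmodType F) (x : hser A) :
  x ⊗ (0 : hser B) = 0.
Proof.
have [_ tDr _ _] := hpure_bilinear A B.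
by apply: (addrI (x ⊗ 0)); rewrite -tDr !addr0.
Qed.

Section Center.
Variables (F : fieldType) (V0 : lmodType F) (V : quantumVertexAlgebra V0).
Local Notation Y := (qva_Y V).
Local Notation S := (qva_S V).
Implicit Types u v w : hser V0.

(** The coefficient of z^n is the r-product with r = -n-1, and r >= 0 exactly when n < 0. *)
Lemma center_Y_eq0 v w n : center V v -> n < 0 -> Y (w ⊗ v) n = 0.
Proof.
move=> /(_ w (- n - 1)) + n0; rewrite /rprod opprB opprK addrAC subrr add0r.
by apply; lia.
Qed.

Lemma iterY_center_eq0 (t : hser (tensor V0 V0)) u p q :
  center V u -> q < 0 -> iterY Y (t ⊗ u) p q = 0.
Proof.
move=> uZ q0; have [tDl tDr tZl tZr] := hpure_bilinear V0 V0.
rewrite /iterY hlift3_purel => [|z|x y].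
- rewrite [X in hlift X](_ : _ = fun _ _ => 0) ?hlift0f ?linear0 //.
  by apply/funext => a; apply/funext => b; rewrite center_Y_eq0 // hpure0r.
- split=> [x x' y|x y y'|k x y|k x y]; rewrite ?tDl ?tZl //.
    by rewrite linearD /= tDr.
  by rewrite linearZ /= tZr.
- by move=> k z z'; rewrite tDr tZr linearP /= tDr tZr.
Qed.

Lemma iterYS_center_eq0 (t : hser (tensor V0 V0)) u p q :
  center V u -> q < 0 -> iterYS Y S t u p q = 0.
Proof.
move=> uZ q0; apply: hsum_eq0 => -[i [j|j]] /=.
  by apply: iterY_center_eq0 => //; lia.
(* At a negative exponent of z2 [subst_bin] is 0, written here as [0 ⊗ 0] to make [iterY_pure]
   applicable. *)
by rewrite -(hpure0r _ (0 : hser V0)) iterY_pure !hpure0l linear0.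
Qed.

Lemma iterY_center_bounded u v w n : center V v -> center V u ->
  exists N : int, forall p q, p < N -> hcoef (iterY Y (w ⊗ v ⊗ u) p q) n = 0.
Proof.
(* Membership in [hideal n.+1] is what kills the coefficient of h^n. The bound is -l because z1^l X
   will have no negative power of z1. *)
move=> vZ uZ; have [l Yl] := qva_assoc V u w v n.+1; exists (- l%:Z) => p q pl.
pose X a b := Y (w ⊗ Y (v ⊗ u) b) a.
have X0 a b : b < 0 -> X a b = 0.
  by move=> b0; rewrite /X (center_Y_eq0 _ uZ) // hpure0r linear0.
rewrite iterY_pure -/(X p q) -[p](addrK l%:Z).
apply: (@subst_assoc_low _ (fun a b => X (a - l%:Z) b)) => [a b|{pl}p {}q p0|].
- exact: X0.
- rewrite -iter_mul_bin_subst_assoc //.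
  have /hidealP/(_ n (ltnSn n)) := Yl p q.
  (* Centrality of v leaves no negative power of z0 in Y(Y(w, z0)v, z2)u, and multiplying by z0 + z2
     creates none. *)
  rewrite [X in _ - X](@mul_bin_low _ _ 0) ?subr0 // => a b a0.
  by rewrite (center_Y_eq0 _ vZ) // hpure0l linear0.
- lia.
Qed.

End Center.

Theorem proposition3p8 (R : realType) (V0 : lmodType R[i])
    (V : quantumVertexAlgebra V0) (w v u : hser V0) :
  center V v -> center V u ->
  iterYS (qva_Y V) (qva_S V) (v ⊗ w) u = iterY21 (qva_Y V) (w ⊗ v ⊗ u).
Proof.
move=> vZ uZ; apply/funext => p; apply/funext => q; apply: hserP => n.
have [N YN] := iterY_center_bounded w n vZ uZ.
have [l /(_ u) YSl] := qva_locality V v w n.+1.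
apply: subr0_eq; move: p q.
pose A p q := hcoefn n (iterYS (qva_Y V) (qva_S V) (v ⊗ w) u p q -
  iterY21 (qva_Y V) (w ⊗ v ⊗ u) p q).
(* The bound 0 serves [iterYS] and N serves [iterY21], whose swap of variables turns a bound on the
   first exponent into one on that of z2. *)
apply: (@mul_bin_inj _ (-1) (Order.min 0 N) l A) => p q.
- rewrite lt_min => /andP[q0 qN].
  by rewrite /A iterYS_center_eq0 // /hcoefn hcoefD hcoefN YN // subr0.
- have /hidealP/(_ n (ltnSn n)) := YSl p q.
  by rewrite -mul_binB -[LHS]/(hcoefn n _) mul_bin_raddf.
Qed.
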